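(* Let $\mathbb{K}$ be a field of characteristic different from $2$, and let $n\ge 1$. Then $\mathrm{JMS}(M_n(\mathbb{K})^+)=\mathrm{End}_{\mathbb{K}}(M_n(\mathbb{K}))$. That is, every $\mathbb{K}$-linear endomorphism of the $\mathbb{K}$-vector space $M_n(\mathbb{K})$ is a finite composition of Jordan multiplication operators $\mathrm{L}_A$, $A\in M_n(\mathbb{K})$.
   Context: $M_n(\mathbb{K})$ is the algebra of $n\times n$ matrices over $\mathbb{K}$, and $M_n(\mathbb{K})^+$ is the special Jordan algebra with the same underlying vector space and product $A\circ B:=\frac12(AB+BA)$. For $A\in M_n(\mathbb{K})$, the multiplication operator $\mathrm{L}_A\colon M_n(\mathbb{K})\to M_n(\mathbb{K})$ is $\mathrm{L}_A(X):=A\circ X$. The Jordan multiplication semigroup $\mathrm{JMS}(M_n(\mathbb{K})^+)$ is the subsemigroup (under composition) of $\mathrm{End}_{\mathbb{K}}(M_n(\mathbb{K}))$ (all $\mathbb{K}$-linear endomorphisms of the vector space $M_n(\mathbb{K})$) generated by all $\mathrm{L}_A$, $A\in M_n(\mathbb{K})$, i.e. the set of all finite products $\mathrm{L}_{A_1}\cdots \mathrm{L}_{A_k}$, $k\ge 1$. It contains the identity since $\mathrm{L}_{I_n}=\mathrm{id}$. *)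

(* Defs.v *)
From HB Require Import structures.
From mathcomp Require Import all_boot all_order all_algebra.

Set Implicit Arguments.
Unset Strict Implicit.
Unset Printing Implicit Defensive.

Import GRing.Theory.
Local Open Scope ring_scope.

Section JordanMultiplication.
Variables (K : fieldType) (n : nat).
Implicit Types A X : 'M[K]_n.

Definition jordan_mul A X : 'M[K]_n := 2^-1 *: (A *m X + X *m A).

Fact jordan_mul_is_linear A : linear (jordan_mul A).
Proof.
move=> a X Y; rewrite /jordan_mul mulmxDr mulmxDl -scalemxAr -scalemxAl.
by rewrite addrACA -scalerDr [LHS]scalerDr !scalerA mulrC.
Qed.

HB.instance Definition _ A :=
  GRing.isLinear.Build K 'M[K]_n 'M[K]_n *:%R (jordan_mul A)
    (jordan_mul_is_linear A).

Definition jordan_L A : 'End('M[K]_n) := linfun (jordan_mul A).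

Lemma jordan_LE A X : jordan_L A X = 2^-1 *: (A *m X + X *m A).
Proof. exact: lfunE. Qed.

(* The generated subsemigroup: the identity is not put in by hand (it is the  *)
(* operator L_1); see JMSP for the description by products L_{A_1}...L_{A_k}  *)
(* with k >= 1.                                                               *)
Inductive JMS : 'End('M[K]_n) -> Prop :=
| JMS_L A : JMS (jordan_L A)
| JMS_comp f g : JMS f -> JMS g -> JMS (f \o g)%VF.

Lemma JMSP f :
  JMS f <-> exists A s,
    f = foldr (fun B g => (jordan_L B \o g)%VF) (jordan_L A) s.
Proof.
split=> [|[A [s ->]]]; last first.
  by elim: s => [|B s IHs] /=; [exact: JMS_L | apply: JMS_comp => //; exact: JMS_L].
elim=> {f} [A | f g _ [A [s ->]] _ [B [t ->]]]; first by exists A, [::].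
exists B, (s ++ A :: t); elim: s => [//|C s IHs] /=.
by rewrite -IHs comp_lfunA.
Qed.

End JordanMultiplication.

(* Main.v *)
From HB Require Import structures.
Require Import Defs.
From mathcomp Require Import all_boot all_order all_algebra.
From mathcomp Require Import ring.

Set Implicit Arguments.
Unset Strict Implicit.
Unset Printing Implicit Defensive.

Import GRing.Theory.
Local Open Scope ring_scope.

(** The semigroup contains every transvection and every dilation of the
    n^2-dimensional space of matrices, and Gaussian elimination writes every
    operator as a product of those.

    Transvections.  Write l_Y for the linear form Z |-> tr (Y Z).  If N is
    nilpotent of rank one, then N Z N = l_N(Z) N, and therefore
    L_(1 + t N) L_(1 - t N) is the transvection Z |-> Z - (t^2 / 2) l_N(Z) N.
    Its coefficients have one sign only: they are minus the halves of squares.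
    The other sign is free when 3, 5 or 7 vanishes in K, since -1 is then a sum
    of ones.  Otherwise, complete N to a pair (N, M) of such nilpotents with
    tr (N M) = 1.  An operator of Peirce type for the idempotent
    (N + M + N M + M N) / 2, with a negative eigenvalue chosen so that its
    inverse is again a product of Jordan multiplications, conjugates the
    transvections along M to transvections in the plane of N and M that turn
    in the opposite direction; with them one realizes a quarter turn of the
    plane, which carries M to a multiple of N and reverses the sign
    (realizable_transvec_flip).  Differences of squares then give all
    coefficients (hyp_pair_transvecs).

    Let (X, Y) stand for the group of transvections Z |-> Z + c l_Y(Z) X.  The
    realized pairs (X, Y) are closed under linear combinations in either
    argument, under exchange of X and Y (the trace form makes each L_A self
    adjoint), under conjugation, and under commutators: (X, Y) and (X', Y')
    give (X, Y') when l_Y(X') is not 0 and l_Y'(X) = 0 (transvecs_trans).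
    Conjugating N by 1 + s M supplies enough further nilpotents to reach
    (N, N M) and (N, M N).  For N = E_ij this joins the basis vector E_ij to
    E_ii and to E_jj, in both directions; all elementary transvections follow
    by transitivity (transvecs_delta).

    Dilations.  Elementary transvections reduce a square matrix to a diagonal
    one, and move its determinant into one chosen diagonal entry.  So a
    dilation of ratio c is realized as soon as some realized operator has
    determinant c.  When c = 0 this is L_A for the diagonal idempotent A with a
    single zero.  When c is not 0, take A equal to the companion block
    [[p, 1], [w, 0]] completed by an identity block; then
    det L_A = - w (p / 2)^2 ((p + 1 - w) / 4)^(2 (n - 2)), and two such factors,
    with p = -2 and p = -1, have a product of determinant exactly c for a
    suitable choice of the two values of w (realizable_dilation). *)

(** * Realizable operators and transvections *)

Section Operators.
Variables (K : fieldType) (n : nat).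
Hypothesis two_neq0 : (2%:R : K) != 0.
Local Notation V := 'M[K]_n.
Implicit Types (X Y Z N M A : V) (f g : V -> V) (a b c s t : K).

(** The semigroup seen through plain functions, so that operators can be
    compared pointwise. *)
Definition realizable g := exists2 f : 'End(V), JMS f & f =1 g.

Lemma eq_realizable f g : f =1 g -> realizable f -> realizable g.
Proof. by move=> fg [h Sh hf]; exists h => // X; rewrite hf. Qed.

Lemma realizable_comp f g : realizable f -> realizable g -> realizable (f \o g).
Proof.
move=> [f' Sf ff'] [g' Sg gg']; exists (f' \o g')%VF; first exact: JMS_comp.
by move=> X; rewrite comp_lfunE /= gg' ff'.
Qed.

Lemma realizable_jordan_mul A : realizable (jordan_mul A).
Proof. by exists (jordan_L A) => [|X]; [exact: JMS_L | rewrite lfunE]. Qed.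

(** The operator L_(1 + A). *)
Definition jordan1D A X := X + 2^-1 *: (A *m X + X *m A).

Lemma realizable_jordan1D A : realizable (jordan1D A).
Proof.
apply: eq_realizable (realizable_jordan_mul (1%:M + A)) => X.
rewrite /jordan1D /jordan_mul mulmxDl mulmxDr mul1mx mulmx1.
move: (A *m X) (X *m A) => B C; apply/matrixP=> i j; rewrite !mxE.
by field.
Qed.

Lemma realizable_id : realizable id.
Proof.
apply: eq_realizable (realizable_jordan1D 0) => X.
by rewrite /jordan1D mul0mx mulmx0 addr0 scaler0 addr0.
Qed.

Definition transvec c X Y : V -> V := fun Z => Z + (c * \tr (Y *m Z)) *: X.

Lemma trDr Y Z Z' : \tr (Y *m (Z + Z')) = \tr (Y *m Z) + \tr (Y *m Z').
Proof. by rewrite mulmxDr mxtraceD. Qed.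

Lemma trZr Y a Z : \tr (Y *m (a *: Z)) = a * \tr (Y *m Z).
Proof. by rewrite -scalemxAr mxtraceZ. Qed.

Lemma trDl Y Z Z' : \tr ((Z + Z') *m Y) = \tr (Z *m Y) + \tr (Z' *m Y).
Proof. by rewrite mulmxDl mxtraceD. Qed.

Lemma trZl Y a Z : \tr ((a *: Z) *m Y) = a * \tr (Z *m Y).
Proof. by rewrite -scalemxAl mxtraceZ. Qed.

Lemma trNl Y Z : \tr ((- Z) *m Y) = - \tr (Z *m Y).
Proof. by rewrite mulNmx raddfN. Qed.

Lemma trNr Y Z : \tr (Y *m (- Z)) = - \tr (Y *m Z).
Proof. by rewrite mulmxN raddfN. Qed.

Definition trLin := (trDr, trZr, trDl, trZl, trNl, trNr).

(** These groups, rather than single transvections, are the objects that the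
    closure rules below manipulate. *)
Definition transvecs X Y :=
  \tr (Y *m X) = 0 /\ forall c, realizable (transvec c X Y).

Lemma transvecD c c' X Y : \tr (Y *m X) = 0 ->
  transvec c X Y \o transvec c' X Y =1 transvec (c + c') X Y.
Proof.
move=> YX Z; rewrite /transvec /= !trLin YX mulr0 addr0.
by rewrite -addrA -scalerDl -mulrDl addrC [c' + c]addrC addrC.
Qed.

Lemma transvecs_Dl X X' Y :
  transvecs X Y -> transvecs X' Y -> transvecs (X + X') Y.
Proof.
move=> [YX SX] [YX' SX']; split=> [|c]; first by rewrite trDr YX YX' addr0.
apply: eq_realizable (realizable_comp (SX c) (SX' c)) => Z.
rewrite /transvec /= !trLin YX' mulr0 addr0.
by rewrite scalerDr -addrA [_ *: X' + _]addrC.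
Qed.

Lemma transvecs_Zl a X Y : transvecs X Y -> transvecs (a *: X) Y.
Proof.
move=> [YX SX]; split=> [|c]; first by rewrite trZr YX mulr0.
apply: eq_realizable (SX (c * a)) => Z.
by rewrite /transvec scalerA mulrAC.
Qed.

(** The Jordan product is commutative and the trace form is associative for
    it, so the semigroup is stable under adjoints; this exchanges the vector
    and the linear form of a transvection. *)
Lemma tr_jordan_mul A X Y :
  \tr (jordan_mul A X *m Y) = \tr (X *m jordan_mul A Y).
Proof.
rewrite /jordan_mul !trLin; congr (_ * _).
by rewrite addrC !mulmxA -[A *m X *m Y]mulmxA [\tr (A *m _)]mxtrace_mulC.
Qed.

Lemma realizable_adjoint f : realizable f ->
  exists2 g, realizable g & forall X Y, \tr (f X *m Y) = \tr (X *m g Y).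
Proof.
move=> [h Sh hf].
suff [g Sg hg] : exists2 g, realizable g &
    forall X Y, \tr (h X *m Y) = \tr (X *m g Y).
  by exists g => // X Y; rewrite -hf hg.
elim: Sh => {f h hf} [A | f1 f2 _ [g1 S1 h1] _ [g2 S2 h2]].
  exists (jordan_mul A); first exact: realizable_jordan_mul.
  by move=> X Y; rewrite lfunE tr_jordan_mul.
exists (g2 \o g1); first exact: realizable_comp.
by move=> X Y; rewrite comp_lfunE /= h1 h2.
Qed.

Lemma tr_deltaE i j (Z : V) : \tr (delta_mx i j *m Z) = Z j i.
Proof.
rewrite /mxtrace (bigD1 i) //= big1 => [|k ki].
  rewrite addr0 mxE (bigD1 j) //= big1 ?addr0 => [|l lj].
    by rewrite mxE !eqxx mul1r.
  by rewrite mxE (negPf lj) andbF mul0r.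
by rewrite mxE big1 // => l _; rewrite mxE (negPf ki) mul0r.
Qed.

Lemma tr_nondeg X Y : (forall Z, \tr (Z *m X) = \tr (Z *m Y)) -> X = Y.
Proof. by move=> e; apply/matrixP=> i j; rewrite -!(tr_deltaE j i) e. Qed.

Lemma transvecsC X Y : transvecs X Y -> transvecs Y X.
Proof.
move=> [YX SX]; split=> [|c]; first by rewrite mxtrace_mulC.
have [g Sg adj] := realizable_adjoint (SX c).
apply: eq_realizable Sg => Z; apply: tr_nondeg => W; rewrite -adj.
rewrite /transvec !trLin [\tr (X *m Z)]mxtrace_mulC [\tr (Z *m X)]mxtrace_mulC.
by rewrite [\tr (Y *m W)]mxtrace_mulC mulrAC.
Qed.

Lemma transvecs_Dr X Y Y' :
  transvecs X Y -> transvecs X Y' -> transvecs X (Y + Y').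
Proof.
by move=> /transvecsC XY /transvecsC XY'; apply/transvecsC/transvecs_Dl.
Qed.

Lemma transvecs_Zr a X Y : transvecs X Y -> transvecs X (a *: Y).
Proof. by move=> /transvecsC XY; apply/transvecsC/transvecs_Zl. Qed.

Lemma transvecs_conj f g X Y Y' :
    realizable f -> realizable g -> cancel g f ->
    (forall a Z Z', f (Z + a *: Z') = f Z + a *: f Z') ->
    (forall Z, \tr (Y *m g Z) = \tr (Y' *m Z)) -> \tr (Y' *m f X) = 0 ->
  transvecs X Y -> transvecs (f X) Y'.
Proof.
move=> Sf Sg gK flin gY Y'fX [YX SX]; split=> // c.
apply: eq_realizable (realizable_comp Sf (realizable_comp (SX c) Sg)) => Z.
by rewrite /transvec /= flin gK gY.
Qed.

(** The commutator of the two transvections: the first one moves X' by a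
    multiple of X and fixes the form of Y', so only a transvection along X with
    the form of Y' survives. *)
Lemma transvecs_trans X Y X' Y' : \tr (Y *m X') != 0 -> \tr (Y' *m X) = 0 ->
  transvecs X Y -> transvecs X' Y' -> transvecs X Y'.
Proof.
move=> nz z [YX SX] [YX' SX']; split=> // c.
pose b := c / \tr (Y *m X').
apply: eq_realizable (realizable_comp (realizable_comp (SX 1) (SX' b))
  (realizable_comp (SX (-1)) (SX' (- b)))) => Z.
rewrite /transvec /= !trLin YX YX' z.
set y := \tr (Y *m Z); set y' := \tr (Y' *m Z).
apply/matrixP=> i j; rewrite !mxE /b; field.
exact: nz.
Qed.
End Operators.

(** * Transvections along nilpotents of rank one *)

Section Pairs.
Variables (K : fieldType) (n : nat).
Hypothesis two_neq0 : (2%:R : K) != 0.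
Local Notation V := 'M[K]_n.
Implicit Types (X Y Z N M A : V) (f g : V -> V) (a b c s t : K).

Let four_neq0 : (4%:R : K) != 0.
Proof. by rewrite (natrM _ 2 2) mulf_neq0. Qed.

(** For N of rank one, N X N = tr (N X) N, and trace zero means square zero.
    (The zero matrix also qualifies.) *)
Definition rank1_nilp N :=
  \tr N = 0 /\ forall X, N *m X *m N = \tr (N *m X) *: N.

Lemma rank1_nilp_sqr0 N : rank1_nilp N -> N *m N = 0.
Proof. by case=> tN /(_ 1%:M); rewrite !mulmx1 tN scale0r. Qed.

(** L_N is nilpotent of order three and 2 L_N^2 is the rank one operator
    X |-> N X N, so the product is 1 - t^2 L_N^2. *)
Lemma jordan1D_nilp N t : rank1_nilp N ->
  jordan1D (t *: N) \o jordan1D (- t *: N) =1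
  transvec (- (2^-1 * t ^+ 2)) N N.
Proof.
move=> rN X; have NN := rank1_nilp_sqr0 rN; case: rN => tN sN.
rewrite /transvec /jordan1D /=.
rewrite !(=^~ scalemxAr, =^~ scalemxAl, mulmxDr, mulmxDl).
rewrite !mulmxA NN -[X *m N *m N]mulmxA NN mulmx0 mul0mx sN.
move: (N *m X) (X *m N) => B C.
by apply/matrixP=> i j; rewrite !mxE; field.
Qed.

Lemma realizable_transvec_neg N t : rank1_nilp N ->
  realizable (transvec (- (2^-1 * t ^+ 2)) N N).
Proof.
move=> rN; apply: eq_realizable (jordan1D_nilp t rN) _.
exact: realizable_comp (realizable_jordan1D two_neq0 _) (realizable_jordan1D two_neq0 _).
Qed.

Lemma realizable_transvec_muln N c k : \tr (N *m N) = 0 ->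
  realizable (transvec c N N) -> realizable (transvec (c *+ k) N N).
Proof.
move=> NN Sc; elim: k => [|k IHk].
  apply: eq_realizable (realizable_id n two_neq0) => X.
  by rewrite /transvec mulr0n mul0r scale0r addr0.
by rewrite mulrS; apply: eq_realizable (realizable_comp Sc IHk); apply: transvecD.
Qed.

(** A positive rational m / k is a sum of halves of squares: 2 m k copies of
    (1 / k)^2 / 2. *)
Lemma realizable_transvec_negq N (m k : nat) : rank1_nilp N ->
  k%:R != 0 :> K -> realizable (transvec (- (m%:R / k%:R)) N N).
Proof.
move=> rN k0; have NN : \tr (N *m N) = 0.
  by rewrite rank1_nilp_sqr0 // mxtrace0.
have := realizable_transvec_muln (2 * m * k)%N NN
  (realizable_transvec_neg k%:R^-1 rN).
rewrite -[_ *+ (2 * m * k)]mulr_natr; congr (realizable (transvec _ _ _)).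
by rewrite !natrM; field; rewrite two_neq0 k0.
Qed.

(** The trace form makes N, M a hyperbolic pair of isotropic vectors; with
    N M - M N they span a copy of sl_2. *)
Definition hyp_pair N M := [/\ rank1_nilp N, rank1_nilp M & \tr (N *m M) = 1].

Lemma hyp_pairC N M : hyp_pair N M -> hyp_pair M N.
Proof. by case=> rN rM NM; split=> //; rewrite mxtrace_mulC. Qed.

(** The operator with matrix 1 + [[a, b], [c, d]] on the plane of N and M, and
    the identity on the orthogonal complement of that plane.  Its composition
    rule is that of 2 x 2 matrices. *)
Definition plane N M a b c d Z :=
  Z + (a * \tr (M *m Z) + b * \tr (N *m Z)) *: N
    + (c * \tr (M *m Z) + d * \tr (N *m Z)) *: M.

Section OnePair.
Variables N M : V.
Hypothesis NM : hyp_pair N M.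

Lemma hyp_pair_rels :
  [/\ N *m N = 0, M *m M = 0, N *m M *m N = N & M *m N *m M = M].
Proof.
case: NM => rN rM tNM; have NN := rank1_nilp_sqr0 rN.
have MM := rank1_nilp_sqr0 rM; split=> //.
  by case: rN => _ ->; rewrite tNM scale1r.
by case: rM => _ ->; rewrite mxtrace_mulC tNM scale1r.
Qed.

Lemma hyp_pair_tr : [/\ \tr (N *m N) = 0, \tr (M *m M) = 0,
  \tr (N *m M) = 1 & \tr (M *m N) = 1].
Proof.
have [-> -> _ _] := hyp_pair_rels; rewrite mxtrace0 [\tr (M *m N)]mxtrace_mulC.
by case: NM.
Qed.

Lemma plane_comp a b c d a' b' c' d' :
  plane N M a b c d \o plane N M a' b' c' d' =1
  plane N M (a + a' + a * a' + b * c') (b + b' + a * b' + b * d')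
            (c + c' + c * a' + d * c') (d + d' + c * b' + d * d').
Proof.
move=> Z; have [NN MM tNM tMN] := hyp_pair_tr.
rewrite /plane /= !trLin NN MM tNM tMN.
by apply/matrixP=> i j; rewrite !mxE; ring.
Qed.

Lemma plane_transvecN c : transvec c N N =1 plane N M 0 c 0 0.
Proof.
by move=> Z; rewrite /plane !mul0r !add0r scale0r addr0.
Qed.

Lemma plane_transvecM c : transvec c M M =1 plane N M 0 0 c 0.
Proof.
by move=> Z; rewrite /plane !mul0r !addr0 scale0r addr0.
Qed.

(** Inside the 2 x 2 blocks spanned by N M, N, M, M N this is half the matrix
    with all entries 1. *)
Definition pair_idem : V := 2^-1 *: (N + M + N *m M + M *m N).

Lemma pair_idemK : pair_idem *m pair_idem = pair_idem.
Proof.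
have [NN MM NMN MNM] := hyp_pair_rels.
rewrite /pair_idem -!(scalemxAr, scalemxAl) !mulmxDl !mulmxDr !mulmxA.
rewrite NN MM NMN MNM -[M *m N *m N]mulmxA -[N *m M *m M]mulmxA NN MM.
rewrite !(mul0mx, mulmx0, add0r, addr0).
move: (N *m M) (M *m N) => B C.
by apply/matrixP=> i j; rewrite !mxE; field.
Qed.

End OnePair.

(** For an idempotent A this is the identity on the Peirce spaces of A for the
    eigenvalues 0 and 1 of L_A, and multiplication by 1 + k on the one for 1/2. *)
Definition peirce A k : V -> V :=
  fun Z => Z + k *: (A *m Z + Z *m A - 2 *: (A *m Z *m A)).

(** It is L_(1 + b A) L_(1 + b' A): the two factors cancel on the Peirce space
    for 1 and multiply the one for 1/2 by (1 + b / 2) (1 + b' / 2). *)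
Lemma realizable_peirce A b b' : A *m A = A -> (1 + b) * (1 + b') = 1 ->
  realizable (peirce A (- (b * b' / 4%:R))).
Proof.
move=> AA bb'.
apply: eq_realizable (realizable_comp (realizable_jordan1D two_neq0 (b *: A))
  (realizable_jordan1D two_neq0 (b' *: A))) => X.
rewrite /peirce /jordan1D /= !(=^~ scalemxAr, =^~ scalemxAl, mulmxDr, mulmxDl).
rewrite !mulmxA AA -[X *m A *m A]mulmxA AA.
move: (A *m X) (X *m A) (A *m X *m A) => B C D.
apply/matrixP=> i j; rewrite !mxE.
have h : b * b' = - b - b'.
  have -> : b * b' = (1 + b) * (1 + b') - 1 - b - b' by ring.
  by rewrite bb'; ring.
by field: h; rewrite four_neq0.
Qed.

Lemma tr_peirce A k X Y : \tr (X *m peirce A k Y) = \tr (peirce A k X *m Y).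
Proof.
rewrite /peirce !trLin; congr (_ + k * (_ - _ * _)); last first.
  by rewrite mulmxA mxtrace_mulC !mulmxA.
by rewrite addrC; congr (_ + _); rewrite !mulmxA // mxtrace_mulC mulmxA.
Qed.

Lemma peirceD A k k' : A *m A = A ->
  peirce A k \o peirce A k' =1 peirce A (k + k' + k * k').
Proof.
move=> AA X.
rewrite /peirce /= !(=^~ scalemxAr, =^~ scalemxAl, mulmxDr, mulmxDl, mulmxN, mulNmx).
rewrite !mulmxA AA -![_ *m A *m A]mulmxA AA.
move: (A *m X) (X *m A) (A *m X *m A) => B C D.
by apply/matrixP=> i j; rewrite !mxE; ring.
Qed.

Lemma peirce_linear A k a X Y :
  peirce A k (X + a *: Y) = peirce A k X + a *: peirce A k Y.
Proof.
rewrite /peirce !(=^~ scalemxAr, =^~ scalemxAl, mulmxDr, mulmxDl).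
by apply/matrixP=> i j; rewrite !mxE; ring.
Qed.

Section PositiveCoefficients.
Variables N M : V.
Hypothesis NM : hyp_pair N M.
Let A := pair_idem N M.

Lemma peirce_pair k : peirce A k M = M + (k / 2) *: (M - N).
Proof.
have [NN MM NMN MNM] := hyp_pair_rels NM.
rewrite /peirce /A /pair_idem -!(scalemxAr, scalemxAl) !(mulmxDl, mulmxDr) !mulmxA.
rewrite MM NMN MNM -[N *m M *m M]mulmxA MM !(mul0mx, mulmx0, add0r, addr0).
rewrite MNM.
move: (N *m M) (M *m N) => B C.
by apply/matrixP=> i j; rewrite !mxE; field.
Qed.

(** The condition on k and k' says that the two Peirce operators are inverse to
    each other, so this is a conjugate of a transvection along M. *)
Lemma plane_peirce k k' c : k + k' + k * k' = 0 ->
  peirce A k \o transvec c M M \o peirce A k' =1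
  plane N M (- (c * (k / 2) * (1 + k' / 2))) (c * (k / 2) * (k' / 2))
    (c * (1 + k / 2) * (1 + k' / 2)) (- (c * (1 + k / 2) * (k' / 2))).
Proof.
move=> kk' Z; rewrite /transvec /=.
have AA : A *m A = A := pair_idemK NM.
rewrite peirce_linear tr_peirce !peirce_pair // [X in X + _](peirceD k k' AA Z) kk'.
rewrite /plane /peirce scale0r addr0 !trLin.
by apply/matrixP=> i j; rewrite !mxE; ring.
Qed.

(** A quarter turn of the plane conjugates transvections along M to
    transvections along N with the opposite sign.  The Peirce multiplier must
    be negative in order to reverse the orientation of the plane, and it must be
    inverse to another realizable multiplier.  With
    1 + b = (1 - s) / (1 + s) the multiplier is 1 / (1 - s^2), so two of them
    are inverse when 1 / s^2 + 1 / t^2 = 1; the Pythagorean triple 3, 4, 5 gives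
    s = 5 / 4 and t = 5 / 3, hence the multipliers -16 / 9 and -9 / 16. *)
Lemma realizable_transvec_flip : 3%:R != 0 :> K -> 5%:R != 0 :> K ->
  7%:R != 0 :> K -> forall c, realizable (transvec (- c) M M) ->
  realizable (transvec (c * (25%:R / 7%:R) ^+ 2) N N).
Proof.
move=> n3 n5 n7 c Sc; have [rN rM _] := NM.
have n25 : 25%:R != 0 :> K by rewrite (natrM _ 5 5) mulf_neq0.
have n9 : 9%:R != 0 :> K by rewrite (natrM _ 3 3) mulf_neq0.
have n4 : 4%:R != 0 :> K by rewrite (natrM _ 2 2) mulf_neq0.
have n16 : 16%:R != 0 :> K by rewrite (natrM _ 4 4) mulf_neq0.
have n175 : 175%:R != 0 :> K by rewrite (natrM _ 25 7) mulf_neq0.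
have AA : A *m A = A := pair_idemK NM.
have S1 : realizable (peirce A (- (25%:R / 9%:R))).
  have := @realizable_peirce A (- (10%:R / 9%:R)) (- 10%:R) AA _.
  have -> : - (10%:R / 9%:R) * - 10%:R / 4%:R = 25%:R / 9%:R :> K by field; rewrite ?n9 ?n4.
  by apply; field.
have S2 : realizable (peirce A (- (25%:R / 16%:R))).
  have := @realizable_peirce A (- (5%:R / 4%:R)) (- 5%:R) AA _.
  have -> : - (5%:R / 4%:R) * - 5%:R / 4%:R = 25%:R / 16%:R :> K by field; rewrite ?n16 ?n4.
  by apply; field.
pose x : K := 25%:R / 7%:R.
(* The coefficient 576 / 175 makes the lower right entry of this conjugate
   equal to 2 and its upper left entry 0. *)
have Sp : realizable (plane N M (-1) (- x) x^-1 1).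
  have Sq := realizable_transvec_negq 576 rM n175.
  apply: eq_realizable (realizable_comp (realizable_comp S1 Sq) S2) => Z.
  rewrite plane_peirce; last by field; rewrite ?n9 ?n16.
  by congr (plane _ _ _ _ _ _ _); rewrite /x; field;
    rewrite ?n25 ?n7 ?n175 ?n9 ?n16 ?two_neq0.
(* A further transvection along N clears the entry 2: what remains is a quarter
   turn, whose fourth power is the identity and whose cube is its inverse. *)
have Sw : realizable (plane N M (-1) (- x) x^-1 (-1)).
  have Sq := realizable_transvec_negq 50 rN n7.
  apply: eq_realizable (realizable_comp Sp Sq) => Z.
  rewrite /= (plane_transvecN N M) [LHS]plane_comp //.
  by congr (plane _ _ _ _ _ _ _); rewrite /x; field; rewrite ?n25 ?n7.
have Sw' : realizable (plane N M (-1) x (- x^-1) (-1)).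
  apply: eq_realizable (realizable_comp Sw (realizable_comp Sw Sw)) => Z.
  rewrite /= [plane N M _ _ _ _ (plane _ _ _ _ _ _ Z)]plane_comp // [LHS]plane_comp //.
  by congr (plane _ _ _ _ _ _ _); rewrite /x; field; rewrite ?n25 ?n7.
apply: eq_realizable (realizable_comp Sw (realizable_comp Sc Sw')) => Z.
rewrite /= (plane_transvecM N M) (plane_transvecN N M).
rewrite [plane N M _ _ _ _ (plane _ _ _ _ _ _ Z)]plane_comp // [LHS]plane_comp //.
by congr (plane _ _ _ _ _ _ _); rewrite /x; field; rewrite ?n25 ?n7.
Qed.

(** If 3, 5 or 7 is zero in K, then -1 is a natural number in K and iterating
    the transvection suffices; otherwise the flip is available. *)
Lemma realizable_transvec_pos t : realizable (transvec (2^-1 * t ^+ 2) N N).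
Proof.
have [rN rM tNM] := NM; have [NN MM _ _] := hyp_pair_tr NM.
have small p : p.+1%:R = 0 :> K -> realizable (transvec (2^-1 * t ^+ 2) N N).
  move=> p0; have := realizable_transvec_muln p NN (realizable_transvec_neg t rN).
  rewrite -[_ *+ p]mulr_natr; have -> : p%:R = - 1 :> K.
    by apply/eqP; rewrite -addr_eq0 natr1 p0.
  by rewrite mulrN1 opprK.
have [/small //|n3] := eqVneq (3%:R : K) 0.
have [/small //|n5] := eqVneq (5%:R : K) 0.
have [/small //|n7] := eqVneq (7%:R : K) 0.
have n25 : 25%:R != 0 :> K by rewrite (natrM _ 5 5) mulf_neq0.
have := realizable_transvec_flip n3 n5 n7
  (realizable_transvec_neg (t * 7%:R / 25%:R) rM).
by congr (realizable (transvec _ _ _)); field; rewrite n7 n25 two_neq0.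
Qed.

(** Every c is a difference of two halves of squares:
    2 c = (c + 1/2)^2 - (c - 1/2)^2. *)
Lemma hyp_pair_transvecs : transvecs N N.
Proof.
have [rN rM tNM] := NM; have [NN MM _ _] := hyp_pair_tr NM.
split=> // c.
have := realizable_comp (realizable_transvec_pos (c + 2^-1))
  (realizable_transvec_neg (c - 2^-1) rN).
apply: eq_realizable => Z; rewrite transvecD //.
by congr (transvec _ _ _ _); field.
Qed.

End PositiveCoefficients.
End Pairs.

(** * Reaching the diagonal directions of a hyperbolic pair *)

Section Cartan.
Variables (K : fieldType) (n : nat).
Hypothesis two_neq0 : (2%:R : K) != 0.
Local Notation V := 'M[K]_n.
Implicit Types (X Y Z N M A : V) (f g : V -> V) (a b c s t : K).

Lemma rank1_nilp_conj A B N : A *m B = 1%:M ->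
  rank1_nilp N -> rank1_nilp (A *m N *m B).
Proof.
move=> AB [tN sN]; have BA := mulmx1C AB; split=> [|X].
  by rewrite mxtrace_mulC mulmxA BA mul1mx.
have -> : A *m N *m B *m X *m (A *m N *m B) = A *m (N *m (B *m X *m A) *m N) *m B.
  by rewrite !mulmxA.
rewrite sN -scalemxAr -scalemxAl; congr (_ *: _).
have -> : A *m N *m B *m X = A *m (N *m B *m X) by rewrite !mulmxA.
by rewrite [RHS]mxtrace_mulC !mulmxA.
Qed.

Section OnePair.
Variables N M : V.
Hypothesis NM : hyp_pair N M.
Let H := N *m M - M *m N.
Let E := N *m M + M *m N.

(** The first matrix is (1 + s M) N (1 - s M); this conjugation fixes M. *)
Lemma hyp_pair_conj s : hyp_pair (N - s *: H - s ^+ 2 *: M) M.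
Proof.
have [NN MM NMN MNM] := hyp_pair_rels NM; have [rN rM tNM] := NM.
have inv : (1%:M + s *: M) *m (1%:M - s *: M) = 1%:M.
  rewrite mulmxDl !mulmxBr !mulmx1 !mul1mx -scalemxAl -scalemxAr MM !scaler0.
  by rewrite subr0 subrK.
have -> : N - s *: H - s ^+ 2 *: M = (1%:M + s *: M) *m N *m (1%:M - s *: M).
  rewrite !mulmxDl !mulmxBr !mul1mx !mulmx1 -!scalemxAl -!scalemxAr MNM /H.
  move: (N *m M) (M *m N) => B C.
  by apply/matrixP=> i j; rewrite !mxE; ring.
split=> //; first exact: rank1_nilp_conj.
have BM : (1%:M - s *: M) *m M = M.
  by rewrite mulmxBl mul1mx -scalemxAl MM scaler0 subr0.
have MA : M *m (1%:M + s *: M) = M.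
  by rewrite mulmxDr mulmx1 -scalemxAr MM scaler0 addr0.
by rewrite -mulmxA BM -mulmxA mxtrace_mulC -mulmxA MA.
Qed.

Lemma hyp_pair_tr_cartan : [/\ \tr (H *m N) = 0, \tr (H *m M) = 0,
  \tr (E *m N) = 0, \tr (E *m H) = 0 & \tr (H *m H) = 2%:R].
Proof.
have [NN MM NMN MNM] := hyp_pair_rels NM; have [[tN _] [tM _] tNM] := NM.
rewrite /E /H !(mulmxDl, mulmxDr, mulmxN, mulNmx) !mulmxA NMN MNM.
rewrite -![_ *m N *m N]mulmxA NN -![_ *m M *m M]mulmxA MM !mulmx0 !mul0mx.
rewrite !(raddfD, raddfN, mxtrace0) /= tN tM [\tr (M *m N)]mxtrace_mulC tNM.
by split; ring.
Qed.

(** The matrices N - H - M and N + H - M are conjugate to N, so their own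
    transvections are realized.  Commutators with the transvections
    (M - N, M + N) replace their forms by that of M + N, which isolates H in
    the difference. *)
Lemma transvecs_commutator : transvecs N H.
Proof.
have NMp := hyp_pair_conj; have [NN MM tNM tMN] := hyp_pair_tr NM.
have [tHN tHM _ _ _] := hyp_pair_tr_cartan.
have tNH : \tr (N *m H) = 0 by rewrite mxtrace_mulC.
have tMH : \tr (M *m H) = 0 by rewrite mxtrace_mulC.
have RN := hyp_pair_transvecs two_neq0 NM.
(* The linearity rules of the trace must not see through H. *)
clearbody H E; have RM := hyp_pair_transvecs two_neq0 (hyp_pairC NM).
have R1 : transvecs (M - N) (M + N).
  have -> : M - N = transvec (-1) N N M.
    by rewrite /transvec tNM mulr1 scaleN1r.
  apply: (transvecs_conj (RN.2 (-1)) (RN.2 1) _ _ _ _ RM) => [Z|a Z Z'|Z|].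
  - by rewrite [LHS](transvecD _ _ NN) /transvec addNr mul0r scale0r addr0.
  - rewrite /transvec !trLin; apply/matrixP=> i j; rewrite !mxE; ring.
  - by rewrite /transvec !trLin tMN; ring.
  - by rewrite /transvec !trLin NN MM tNM tMN; ring.
have R2 s : s ^+ 2 = 1 -> transvecs (N - s *: H - M) (M + N).
  move=> s2; have RP := hyp_pair_transvecs two_neq0 (NMp s).
  rewrite s2 scale1r in RP; apply: transvecs_trans RP R1.
    rewrite !trLin NN MM tNM tMN tHN tHM.
    by rewrite (_ : _ + _ = 2%:R) //; ring.
  by rewrite !trLin NN MM tNM tMN tNH tMH; ring.
have m1 : (-1) ^+ 2 = 1 :> K by rewrite sqrrN expr1n.
have R3 : transvecs (M + N) H.
  apply: transvecsC.
  have := transvecs_Dl (R2 (-1) m1) (transvecs_Zl (-1) (R2 1 (expr1n _ _))).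
  move/(transvecs_Zl 2^-1).
  by congr (transvecs _ _); apply/matrixP=> i j; rewrite [LHS]mxE !mxE; field.
apply: transvecs_trans RN R3.
  by rewrite trDr NN tNM addr0 oner_neq0.
exact: tHN.
Qed.

(** The operator L_(1 + M) fixes the form of H, because M and H anticommute,
    and it sends N to N + E / 2: this is how one leaves the traceless
    matrices. *)
Lemma transvecs_anticommutator : transvecs N E.
Proof.
have [NN MM NMN MNM] := hyp_pair_rels NM.
have [tNN tMM tNM tMN] := hyp_pair_tr NM.
have [tHN tHM tEN tEH tHH] := hyp_pair_tr_cartan.
have RM := hyp_pair_transvecs two_neq0 (hyp_pairC NM).
have RH := transvecs_commutator.
have HMM : M *m H + H *m M = 0.
  rewrite /H mulmxBr mulmxBl !mulmxA MNM MM mul0mx subr0.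
  by rewrite -[N *m M *m M]mulmxA MM mulmx0 sub0r subrr.
have tHf X s : \tr (H *m jordan1D (s *: M) X) = \tr (H *m X).
  rewrite /jordan1D trDr trZr mulmxDr mxtraceD !mulmxA.
  rewrite [\tr (_ *m X *m _)]mxtrace_mulC !mulmxA -mxtraceD -mulmxDl.
  by rewrite -scalemxAl -scalemxAr -scalerDr addrC [H *m M + _]addrC HMM
    scaler0 mul0mx mxtrace0 mulr0 add0r.
have NME : jordan1D (1 *: M) N = N + 2^-1 *: E.
  by rewrite /jordan1D scale1r [M *m N + _]addrC.
have RfN : transvecs (N + 2^-1 *: E) H.
  have Sg := realizable_comp (realizable_jordan1D two_neq0 (- 1 *: M)) (RM.2 2^-1).
  rewrite -NME.
  apply: (transvecs_conj (realizable_jordan1D two_neq0 (1 *: M)) Sg _ _ _ _ RH).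
  - move=> Z; have [_ rM _] := NM.
    rewrite [LHS](jordan1D_nilp two_neq0 _ rM) expr1n mulr1 [LHS]transvecD //.
    by rewrite addNr /transvec mul0r scale0r addr0.
  - move=> a Z Z'; rewrite /jordan1D !(=^~ scalemxAr, =^~ scalemxAl, mulmxDr, mulmxDl).
    by apply/matrixP=> i j; rewrite !mxE; ring.
  - by move=> Z; rewrite /= tHf /transvec trDr trZr tHM mulr0 addr0.
  - by rewrite tHf tHN.
have RE : transvecs E H.
  have := transvecs_Zl 2 (transvecs_Dl RfN (transvecs_Zl (-1) RH)).
  by congr (transvecs _ _); apply/matrixP=> i j; rewrite [LHS]mxE !mxE; field.
apply: transvecs_trans RH (transvecsC RE) => //.
by rewrite tHH.
Qed.

(** N M and M N are the half sum and the half difference of E and H. *)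
Lemma transvecs_products : transvecs N (N *m M) /\ transvecs N (M *m N).
Proof.
have [RH RE] := (transvecs_commutator, transvecs_anticommutator); split.
  have := transvecs_Zr 2^-1 (transvecs_Dr RE RH).
  by congr (transvecs _ _); apply/matrixP=> i j; rewrite /E /H [LHS]mxE !mxE; field.
have := transvecs_Zr 2^-1 (transvecs_Dr RE (transvecs_Zr (-1) RH)).
by congr (transvecs _ _); apply/matrixP=> i j; rewrite /E /H [LHS]mxE !mxE; field.
Qed.

End OnePair.
End Cartan.

(** * All elementary transvections *)

Section MatrixUnits.
Variables (K : fieldType) (n : nat).
Hypothesis two_neq0 : (2%:R : K) != 0.
Local Notation V := 'M[K]_n.

Lemma mul_delta_mxE (a b : 'I_n) (X : V) :
  delta_mx a b *m X = \matrix_(i, j) ((i == a)%:R * X b j).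
Proof.
apply/matrixP=> i j; rewrite [RHS]mxE mxE (bigD1 b) //= big1 ?addr0 => [|k kb].
  by rewrite mxE eqxx andbT.
by rewrite mxE (negPf kb) andbF mul0r.
Qed.

Lemma mul_mx_deltaE (a b : 'I_n) (X : V) :
  X *m delta_mx a b = \matrix_(i, j) (X i a * (j == b)%:R).
Proof.
apply/matrixP=> i j; rewrite [RHS]mxE mxE (bigD1 a) //= big1 ?addr0 => [|k ka].
  by rewrite mxE eqxx.
by rewrite mxE (negPf ka) mulr0.
Qed.

Lemma hyp_pair_delta i j : i != j ->
  hyp_pair (delta_mx i j : V) (delta_mx j i).
Proof.
have r1 (a b : 'I_n) : a != b -> rank1_nilp (delta_mx a b : V).
  move=> ab; split=> [|X].
    by rewrite -[delta_mx a b]mulmx1 tr_deltaE mxE eq_sym (negPf ab).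
  rewrite tr_deltaE; apply/matrixP=> k l.
  by rewrite mul_mx_deltaE mul_delta_mxE !mxE mulrAC -natrM mulnb mulrC.
move=> ij; split; [exact: r1 | by apply: r1; rewrite eq_sym |].
by rewrite tr_deltaE mxE !eqxx.
Qed.

(** The relation between basis vectors p and q given by a realized transvection
    along p with the coordinate form of q, made reflexive, is transitive.  It
    relates E_ab with E_aa and with E_bb in both directions, so E_ij is related
    to E_kl through E_ii, E_ik and E_kk. *)
Lemma transvecs_delta (i j k l : 'I_n) : (i, j) != (k, l) ->
  transvecs (delta_mx i j : V) (delta_mx l k).
Proof.
pose edge (p q : 'I_n * 'I_n) :=
  p = q \/ transvecs (delta_mx p.1 p.2 : V) (delta_mx q.2 q.1).
have edge_trans p q r : edge p q -> edge q r -> edge p r.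
  case=> [->|pq] //; case=> [<-|qr]; first by right.
  have [->|pr] := eqVneq p r; first by left.
  right; apply: transvecs_trans pq qr.
    by rewrite tr_deltaE mxE !eqxx oner_neq0.
  rewrite tr_deltaE mxE.
  case: eqP => // rp1; case: eqP => // rp2; case/eqP: pr.
  by case: p r rp1 rp2 => ? ? [? ?] /= -> ->.
have diag (a b : 'I_n) : [/\ edge (a, b) (a, a), edge (a, b) (b, b),
    edge (a, a) (a, b) & edge (b, b) (a, b)].
  have [<-|ab] := eqVneq a b; first by split; left.
  have ba : b != a by rewrite eq_sym.
  have [] := transvecs_products two_neq0 (hyp_pair_delta ab).
  have [] := transvecs_products two_neq0 (hyp_pair_delta ba).
  rewrite !mul_delta_mx => Rba_b Rba_a Rab_a Rab_b.
  by split; right=> //=; apply: transvecsC.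
move=> ijkl; suff [ij|//] : edge (i, j) (k, l) by rewrite ij eqxx in ijkl.
have [e1 _ _ _] := diag i j; have [_ e2 e3 _] := diag i k.
have [_ _ e4 _] := diag k l.
exact: edge_trans e1 (edge_trans _ _ _ e3 (edge_trans _ _ _ e2 e4)).
Qed.
End MatrixUnits.

(** * Gaussian elimination by elementary transvections *)

Section Gauss.
Variable (K : fieldType).

Inductive shear_prod N : 'M[K]_N -> Prop :=
| shear_prod1 : shear_prod 1%:M
| shear_prod_shear p q c : p != q -> shear_prod (1%:M + c *: delta_mx p q)
| shear_prodM A B : shear_prod A -> shear_prod B -> shear_prod (A *m B).

Lemma shear_prod_tr N (A : 'M[K]_N) : shear_prod A -> shear_prod A^T.
Proof.
elim=> {A} [|p q c pq|A B _ IHA _ IHB].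
- by rewrite trmx1; apply: shear_prod1.
- rewrite linearD linearZ /= trmx1 trmx_delta.
  by apply: shear_prod_shear; rewrite eq_sym.
- by rewrite trmx_mul; apply: shear_prodM.
Qed.

Lemma shear_prod_inv N (A : 'M[K]_N) :
  shear_prod A -> exists2 B, shear_prod B & A *m B = 1%:M.
Proof.
elim=> {A} [|p q c pq|A B _ [A' sA' AA'] _ [B' sB' BB']].
- by exists 1%:M; [exact: shear_prod1 | rewrite mulmx1].
- exists (1%:M + - c *: delta_mx p q); first exact: shear_prod_shear.
  rewrite mulmxDl !mulmxDr !mulmx1 mul1mx -scalemxAl -scalemxAr.
  rewrite mul_delta_mx_0 1?eq_sym // !scaler0 addr0 -addrA -scalerDl addNr.
  by rewrite scale0r addr0.
- exists (B' *m A'); first exact: shear_prodM.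
  by rewrite mulmxA -[A *m B *m B']mulmxA BB' mulmx1.
Qed.

Lemma shear_prod_drblock N (A : 'M[K]_N) :
  shear_prod A -> shear_prod (block_mx 1%:M 0 0 A : 'M_(1 + N)).
Proof.
elim=> {A} [|p q c pq|A B _ sA _ sB].
- by rewrite -scalar_mx_block; apply: shear_prod1.
- have -> : block_mx 1%:M 0 0 (1%:M + c *: delta_mx p q) =
      1%:M + c *: delta_mx (rshift 1 p) (rshift 1 q) :> 'M[K]_(1 + N).
    rewrite delta_mx_dshift delta_mx_rshift /=.
    by rewrite scalar_mx_block /block_mx scale_col_mx scale_row_mx !add_col_mx !add_row_mx
      ?(scaler0, addr0, add0r).
  by apply: shear_prod_shear; rewrite (inj_eq (@rshift_inj _ _)).
- have := shear_prodM sA sB.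
  by rewrite mulmx_block !(mulmx0, mul0mx, mulmx1, addr0, add0r).
Qed.

Lemma shear_prod_col N (c : 'cV[K]_N) :
  shear_prod (block_mx 1%:M 0 c 1%:M : 'M_(1 + N)).
Proof.
rewrite [c]matrix_sum_delta.
apply: (big_ind (fun c : 'cV[K]_N => shear_prod (block_mx 1%:M 0 c 1%:M : 'M_(1 + N)))).
- by rewrite -scalar_mx_block; apply: shear_prod1.
- move=> x y sx sy; have := shear_prodM sx sy.
  by rewrite mulmx_block !(mulmx0, mul0mx, mulmx1, mul1mx, addr0, add0r).
- move=> i _; rewrite big_ord1.
  have -> : block_mx 1%:M 0 (c i 0 *: delta_mx i 0) 1%:M =
      1%:M + c i 0 *: delta_mx (rshift 1 i) (lshift N 0) :> 'M[K]_(1 + N).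
    rewrite delta_mx_dshift delta_mx_lshift.
    by rewrite scalar_mx_block /block_mx scale_col_mx scale_row_mx !add_col_mx !add_row_mx
      ?(scaler0, addr0, add0r).
  by apply: shear_prod_shear; rewrite eq_rlshift.
Qed.

Lemma shear_prod_row N (r : 'rV[K]_N) :
  shear_prod (block_mx 1%:M r 0 1%:M : 'M_(1 + N)).
Proof.
have := shear_prod_tr (shear_prod_col r^T).
by rewrite tr_block_mx !trmx1 trmxK trmx0.
Qed.

(** Row and column exchanges are not available, so a nonzero entry is added to
    the corner, first through its row and then through its column. *)
Lemma shear_pivot N (M : 'M[K]_(1 + N)) : M != 0 ->
  exists A B, [/\ shear_prod A, shear_prod B & (A *m M *m B) 0 0 != 0].
Proof.
move=> M0; have [i [j Mij]] : exists i j, M i j != 0.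
  have [/existsP[i /existsP[j Mij]]|] := boolP [exists i, exists j, M i j != 0].
    by exists i, j.
  rewrite negb_exists => /forallP nM; case/eqP: M0; apply/matrixP=> i j.
  have := nM i; rewrite negb_exists => /forallP/(_ j); rewrite negbK => /eqP ->.
  by rewrite mxE.
have [A [sA Aj]] : exists A, shear_prod A /\ (A *m M) 0 j != 0.
  have [M0j|M0j] := eqVneq (M 0 j) 0; last first.
    by exists 1%:M; split; [exact: shear_prod1 | rewrite mul1mx].
  exists (1%:M + 1 *: delta_mx 0 i); split.
    by apply: shear_prod_shear; apply: contraNneq Mij => <-; rewrite M0j.
  rewrite mulmxDl mul1mx scale1r mxE M0j add0r mxE (bigD1 i) //= big1 ?addr0.
    by rewrite mxE !eqxx mul1r.
  by move=> k ki; rewrite mxE (negPf ki) andbF mul0r.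
exists A; move: (A *m M) Aj => P P0j.
have [P00|P00] := eqVneq (P 0 0) 0; last first.
  by exists 1%:M; split; [|exact: shear_prod1 | rewrite mulmx1].
exists (1%:M + 1 *: delta_mx j 0); split=> //.
  by apply: shear_prod_shear; apply: contraNneq P0j => ->; rewrite P00.
rewrite mulmxDr mulmx1 scale1r mxE P00 add0r mxE (bigD1 j) //= big1 ?addr0.
  by rewrite mxE !eqxx mulr1.
by move=> k kj; rewrite mxE (negPf kj) mulr0.
Qed.

Lemma shear_diag N (M : 'M[K]_N) :
  exists A B d, [/\ shear_prod A, shear_prod B & A *m M *m B = diag_mx d].
Proof.
elim: N M => [|N IHN] M.
  exists 1%:M, 1%:M, 0; split; try exact: shear_prod1.
  by apply/matrixP=> -[].
have [->|M0] := eqVneq M 0.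
  exists 1%:M, 1%:M, 0; split; try exact: shear_prod1.
  by rewrite mulmx0 mul0mx linear0.
have [A [B [sA sB]]] := shear_pivot M0.
pose M' : 'M[K]_(1 + N) := A *m M *m B; rewrite -/M' => a0.
pose a := M' 0 0; pose r := ursubmx M'; pose c := dlsubmx M'.
have ulE (Q : 'M[K]_(1 + N)) : ulsubmx Q = (Q 0 0)%:M.
  rewrite [LHS]mx11_scalar; congr _%:M.
  by rewrite !mxE; congr (Q _ _); apply: val_inj.
have [A' [B' [d [sA' sB' Dd]]]] := IHN (drsubmx M' - c *m (a^-1 *: r)).
exists (block_mx 1%:M 0 0 A' *m block_mx 1%:M 0 (- a^-1 *: c) 1%:M *m A).
exists (B *m (block_mx 1%:M (- a^-1 *: r) 0 1%:M *m block_mx 1%:M 0 0 B')).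
exists (row_mx a%:M d); split.
- by do 2?apply: shear_prodM => //; [exact: shear_prod_drblock | exact: shear_prod_col].
- by do 2?apply: shear_prodM => //; [exact: shear_prod_row | exact: shear_prod_drblock].
have key : block_mx 1%:M 0 (- a^-1 *: c) 1%:M *m M' *m
    block_mx 1%:M (- a^-1 *: r) 0 1%:M =
    block_mx a%:M 0 0 (drsubmx M' - c *m (a^-1 *: r)).
  rewrite -[M' in LHS]submxK ulE -/r -/c !mulmx_block.
  rewrite !(mulmx0, mul0mx, mulmx1, mul1mx, addr0, add0r).
  rewrite mul_mx_scalar mul_scalar_mx !scalerA mulrN divff // scaleN1r addNr.
  rewrite scaleN1r addNr mul0mx add0r; congr (block_mx _ _ _ _).
  by rewrite addrC -scalemxAl -scalemxAr scaleNr.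
have assoc (X Y Z W : 'M[K]_(1 + N)) :
    X *m Y *m A *m M *m (B *m (Z *m W)) = X *m (Y *m M' *m Z) *m W.
  by rewrite /M' !mulmxA.
rewrite assoc key !mulmx_block !(mulmx0, mul0mx, mulmx1, mul1mx, addr0, add0r) Dd.
apply: etrans (esym (diag_mx_row (a%:M : 'rV_1) d)); congr (block_mx _ _ _ _).
by apply/matrixP=> i j; rewrite !ord1 !mxE.
Qed.

(** The two sides are the determinants of a block matrix computed from its two
    Schur complements. *)
Lemma det1D_rank1 N (u : 'cV[K]_N) (v : 'rV[K]_N) :
  \det (1%:M + u *m v) = 1 + (v *m u) 0 0.
Proof.
have e : (block_mx 1%:M 0 u 1%:M : 'M[K]_(1 + N)) *m block_mx 1%:M (- v) 0 (1%:M + u *m v) =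
    block_mx (1%:M + v *m u) (- v) 0 1%:M *m block_mx 1%:M 0 u 1%:M.
  rewrite !mulmx_block !(mulmx0, mul0mx, mulmx1, mul1mx, addr0, add0r).
  by rewrite mulmxN mulNmx addrK addrC addrK.
have := congr1 (fun M => \det M) e; rewrite !det_mulmx !det_lblock !det_ublock.
by rewrite !det1 !mul1r !mulr1 => ->; rewrite det_mx11 !mxE.
Qed.

Lemma det_shear_prod N (A : 'M[K]_N) : shear_prod A -> \det A = 1.
Proof.
elim=> {A} [|p q c pq|A B _ dA _ dB]; first exact: det1.
  rewrite -(mul_delta_mx (0 : 'I_1)) scalemxAl det1D_rank1 -scalemxAr.
  by rewrite mul_delta_mx_0 1?eq_sym // scaler0 mxE addr0.
by rewrite det_mulmx dA dB mulr1.
Qed.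

End Gauss.

(** * Generation by elementary transvections and dilations *)

Section Dilations.
Variables (K : fieldType) (N : nat).
Implicit Types (p q : 'I_N) (x a b c d : K).

(** The matrix 1 + [[a, b], [c, d]] in the coordinates p and q, completed by an
    identity. *)
Definition coord_plane p q a b c d : 'M[K]_N :=
  1%:M + a *: delta_mx p p + b *: delta_mx p q
       + c *: delta_mx q p + d *: delta_mx q q.

Lemma coord_planeM p q a b c d a' b' c' d' : p != q ->
  coord_plane p q a b c d *m coord_plane p q a' b' c' d' =
  coord_plane p q (a + a' + a * a' + b * c') (b + b' + a * b' + b * d')
                  (c + c' + c * a' + d * c') (d + d' + c * b' + d * d').
Proof.
move=> pq; have qp : q != p by rewrite eq_sym.
rewrite /coord_plane !(mulmxDl, mulmxDr, mul1mx, mulmx1) -!(scalemxAl, scalemxAr).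
rewrite !(mul_delta_mx, mul_delta_mx_0) // !scaler0.
by apply/matrixP=> i j; rewrite !mxE; ring.
Qed.

Definition dilation p c : 'M[K]_N := diag_mx (\row_j if j == p then c else 1).

Lemma dilation_planel p q c : p != q -> dilation p c = coord_plane p q (c - 1) 0 0 0.
Proof.
move=> pq; apply/matrixP=> i j; rewrite !mxE !mul0r !addr0.
have [->|ij] := eqVneq i j; rewrite ?andbb; first by case: eqP => _ /=; ring.
case: eqP => [ip|_] /=; last by rewrite mulr0 addr0.
by case: eqP => [jp|_]; [rewrite ip jp eqxx in ij | rewrite mulr0 addr0].
Qed.

Lemma coord_planeC p q a b c d : coord_plane p q a b c d = coord_plane q p d c b a.
Proof. by apply/matrixP=> i j; rewrite !mxE; ring. Qed.

Lemma shear_prod_weyl p q x : p != q -> x != 0 ->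
  shear_prod (coord_plane p q (- 1) x (- x^-1) (- 1)).
Proof.
move=> pq x0; have qp : q != p by rewrite eq_sym.
have Spq y : shear_prod (coord_plane p q 0 y 0 0).
  by rewrite /coord_plane !scale0r !addr0; apply: shear_prod_shear.
have Sqp y : shear_prod (coord_plane p q 0 0 y 0).
  by rewrite /coord_plane !scale0r !addr0; apply: shear_prod_shear.
have := shear_prodM (shear_prodM (Spq x) (Sqp (- x^-1))) (Spq x).
rewrite !coord_planeM //.
by congr (shear_prod (coord_plane _ _ _ _ _ _)); field; rewrite ?x0.
Qed.

Lemma shear_prod_torus p q x : p != q -> x != 0 ->
  shear_prod (coord_plane p q (x - 1) 0 0 (x^-1 - 1)).
Proof.
move=> pq x0.
have m1 : - 1 != 0 :> K by rewrite oppr_eq0 oner_neq0.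
have := shear_prodM (shear_prod_weyl pq x0) (shear_prod_weyl pq m1).
rewrite !coord_planeM //.
by congr (shear_prod (coord_plane _ _ _ _ _ _)); field; rewrite ?x0 ?m1.
Qed.

Section Closed.
Variable P : 'M[K]_N -> Prop.
Hypothesis PM : forall A B, P A -> P B -> P (A *m B).
Hypothesis P_shear : forall A, shear_prod A -> P A.

(** Diagonal matrices diag (x, 1 / x) in two coordinates are products of
    elementary transvections; they move the entries of d, one after the other,
    into position p.  The entry at p itself may vanish. *)
Lemma dilation_of_diag p (d : 'rV[K]_N) : P (diag_mx d) ->
  (forall q, q != p -> d 0 q != 0) -> P (dilation p (\prod_q d 0 q)).
Proof.
move=> Pd d0.
pose ds (s : seq 'I_N) : 'rV[K]_N := \row_j (if j == p then d 0 p * \prod_(q <- s) d 0 q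
  else if j \in s then 1 else d 0 j).
have Pds s : uniq s -> p \notin s -> P (diag_mx (ds s)).
  elim: s => [|q s IHs] /= => [_ _|/andP[qs us]].
    suff -> : ds [::] = d by [].
    apply/rowP=> j; rewrite mxE big_nil mulr1.
    by case: eqP => [->|].
  rewrite inE negb_or => /andP[pq ps].
  have x0 : (d 0 q)^-1 != 0 by rewrite invr_eq0 d0 // eq_sym.
  have qp : q != p by rewrite eq_sym.
  have := PM (IHs us ps) (P_shear (shear_prod_torus qp x0)).
  congr P; apply/matrixP=> i j; rewrite invrK.
  rewrite mul_diag_mx !mxE !mul0r !addr0 big_cons inE.
  have [->|ij] := eqVneq i j; last first.
    rewrite !mulr0n add0r.
    have N0 k : (i == k) && (j == k) = false.
      by apply: contra_neqF ij => /andP[/eqP -> /eqP ->].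
    by rewrite !N0 !mulr0 !addr0 mulr0.
  rewrite !andbb !mulr1n.
  have [->|jp] := eqVneq j p.
    by rewrite (negPf pq) /=; ring.
  have [->|jq] := eqVneq j q; last by rewrite /=; ring.
  by rewrite (negPf qs) /=; field; apply: d0.
have := Pds [seq q <- index_enum 'I_N | q != p].
rewrite filter_uniq ?index_enum_uniq // mem_filter eqxx => /(_ isT isT).
congr (P (diag_mx _)); apply/rowP=> j; rewrite !mxE.
rewrite mem_filter mem_index_enum andbT big_filter.
by case: eqP => //= _; rewrite [RHS](bigD1 p).
Qed.

(** A single coordinate suffices for the dilations, because quarter turns
    conjugate it to all others. *)
Lemma shears_and_dilations_generate p0 : (forall c, P (dilation p0 c)) -> forall M, P M.
Proof.
move=> Pdil0.
have Pdil p c : P (dilation p c).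
  have [->//|pp0] := eqVneq p p0.
  have p0p : p0 != p by rewrite eq_sym.
  have m1 : - 1 != 0 :> K by rewrite oppr_eq0 oner_neq0.
  have := PM (PM (P_shear (shear_prod_weyl p0p (oner_neq0 K))) (Pdil0 c))
             (P_shear (shear_prod_weyl p0p m1)).
  rewrite (dilation_planel _ p0p) !coord_planeM // (dilation_planel _ pp0) coord_planeC.
  by congr (P (coord_plane _ _ _ _ _ _)); field; rewrite ?m1 ?oner_neq0.
have Pdiag (d : 'rV[K]_N) : P (diag_mx d).
  pose ds (s : seq 'I_N) : 'rV[K]_N := \row_j if j \in s then d 0 j else 1.
  have Pds s : uniq s -> P (diag_mx (ds s)).
    elim: s => [_|q s IHs /= /andP[qs us]].
      suff -> : diag_mx (ds [::]) = 1%:M by apply/P_shear/shear_prod1.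
      by apply/matrixP=> i j; rewrite !mxE.
    have := PM (Pdil q (d 0 q)) (IHs us); rewrite mulmx_diag.
    congr (P (diag_mx _)); apply/rowP=> j; rewrite !mxE inE.
    by case: eqP => [->|_]; rewrite ?(negPf qs) /= ?mulr1 ?mul1r.
  have := Pds _ (enum_uniq 'I_N); congr (P (diag_mx _)).
  by apply/rowP=> j; rewrite !mxE mem_enum.
move=> M; have [A [B [d [sA sB AMB]]]] := shear_diag M.
have [A' sA' AA'] := shear_prod_inv sA; have [B' sB' BB'] := shear_prod_inv sB.
have -> : M = A' *m diag_mx d *m B'.
  by rewrite -AMB !mulmxA (mulmx1C AA') mul1mx -mulmxA BB' mulmx1.
by do 2?apply: PM; [exact: P_shear | exact: Pdiag | exact: P_shear].
Qed.

Lemma dilation_of_det p M : P M -> \det M != 0 -> P (dilation p (\det M)).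
Proof.
move=> PMM; have [A [B [d [sA sB AMB]]]] := shear_diag M.
have detd : \det M = \prod_q d 0 q.
  rewrite -det_diag -AMB !det_mulmx (det_shear_prod sA) (det_shear_prod sB).
  by rewrite mul1r mulr1.
rewrite detd prodf_seq_neq0 => /allP d0; apply: dilation_of_diag.
  by rewrite -AMB; do 2?apply: PM; [exact: P_shear | exact: PMM | exact: P_shear].
by move=> q _; apply: (implyP (d0 q _)); rewrite // mem_index_enum.
Qed.
End Closed.
End Dilations.

(** * Determinant of a Jordan multiplication *)

Section Determinants.
Variables (K : fieldType) (n : nat).
Local Notation V := 'M[K]_n.
Implicit Types (X Y Z : V) (f g : V -> V).

(** A relation, so that determinants of composites of plain functions can be
    accumulated without proving them linear first. *)
Definition has_det (c : K) f :=
  exists2 M : 'M[K]_(n * n), \det M = c & forall X, mxvec (f X) = mxvec X *m M.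

Lemma eq_has_det c f g : f =1 g -> has_det c f -> has_det c g.
Proof. by move=> fg [M dM Mf]; exists M => // X; rewrite -fg. Qed.

Lemma has_det_comp c d f g :
  has_det c f -> has_det d g -> has_det (c * d) (f \o g).
Proof.
move=> [M <- Mf] [M' <- Mg]; exists (M' *m M); first by rewrite det_mulmx mulrC.
by move=> X; rewrite /= Mf Mg mulmxA.
Qed.

Lemma has_det_tr c f : has_det c f -> has_det c (fun X => (f X^T)^T).
Proof.
pose T := lin_mx (@trmx K n n).
have mT X : mxvec X^T = mxvec X *m T by rewrite mul_vec_lin.
have TT : T *m T = 1%:M.
  apply/row_matrixP=> i; rewrite rowE mulmxA -(vec_mxK (delta_mx 0 i)) -!mT trmxK.
  by rewrite vec_mxK rowE mulmx1.
move=> [M <- Mf]; exists (T *m M *m T).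
  by rewrite !det_mulmx mulrAC -det_mulmx TT det1 mul1r.
by move=> X; rewrite mT Mf mT !mulmxA.
Qed.

Definition set_entry i j (e : V -> K) X : V :=
  \matrix_(k, l) (if (k == i) && (l == j) then e X else X k l).

(** Overwriting one entry by a linear form e is a rank one perturbation of the
    identity.  Determinants are computed below by writing an operator as a
    sequence of such assignments. *)
Lemma has_det_set_entry i j (e : V -> K) : scalar e ->
  has_det (e (delta_mx i j)) (set_entry i j e).
Proof.
move=> lin_e.
pose eL := GRing.isLinear.Build K V K *%R e lin_e.
pose el : {scalar V} := HB.pack e eL.
pose u : 'cV[K]_(n * n) := \col_k (e (vec_mx (delta_mx 0 k)) - vec_mx (delta_mx 0 k) i j).
have uE X : mxvec X *m u = (e X - X i j)%:M.
  rewrite [LHS]mx11_scalar; congr _%:M; rewrite mxE.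
  have {2 3}-> : X = \sum_k mxvec X 0 k *: vec_mx (delta_mx 0 k).
    rewrite -[LHS]mxvecK {1}[mxvec X]row_sum_delta linear_sum.
    by apply: eq_bigr => k _; rewrite linearZ.
  rewrite [e _](linear_sum el) summxE -sumrB; apply: eq_bigr => k _.
  by rewrite [el _](linearZ_LR el) !mxE /= mulrBr.
exists (1%:M + u *m mxvec (delta_mx i j)).
  rewrite det1D_rank1 uE [_%:M _ _]mxE eqxx mulr1n [delta_mx _ _ _ _]mxE !eqxx /=.
  by rewrite addrC subrK.
move=> X; rewrite mulmxDr mulmx1 mulmxA uE mul_scalar_mx -linearZ -linearD.
congr mxvec; apply/matrixP=> k l; rewrite !mxE.
have [->|_] := eqVneq k i; last by rewrite mulr0 addr0.
by have [->|_] := eqVneq l j; rewrite /= ?mulr1 ?mulr0 ?addr0 // addrC subrK.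
Qed.

Variables i0 i1 : 'I_n.
Hypothesis i01 : i0 != i1.

Let i10 : i1 != i0. Proof. by rewrite eq_sym. Qed.

Lemma index_cases i : [\/ i = i0, i = i1 | (i == i0) = false /\ (i == i1) = false].
Proof.
have [->|ii0] := eqVneq i i0; first by constructor 1.
have [->|ii1] := eqVneq i i1; first by constructor 2.
by constructor 3.
Qed.

Let eqE := (eqxx, negPf i01, negPf i10).

(** The matrix [[a, b], [c, d]] acting on rows i0 and i1, in the columns of s
    only. *)
Definition col_op a b c d (s : seq 'I_n) X : V := \matrix_(i, j)
  if j \in s then
    if i == i0 then a * X i0 j + b * X i1 j
    else if i == i1 then c * X i0 j + d * X i1 j else X i j
  else X i j.

Lemma has_det_col_op a b c d s : d != 0 -> uniq s ->
  has_det ((a * d - b * c) ^+ size s) (col_op a b c d s).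
Proof.
move=> d0; elim: s => [_|k s IHs /= /andP[ks us]].
  exists 1%:M; first by rewrite det1.
  by move=> X; rewrite mulmx1; congr mxvec; apply/matrixP=> i j; rewrite mxE.
(* The second row is assigned first; e0 recovers the old X i1 k from it, which
   is why d must be invertible. *)
pose e1 X := c * X i0 k + d * X i1 k.
pose e0 X := (a - b * c / d) * X i0 k + b / d * X i1 k.
have lin1 : scalar e1 by move=> x X Y; rewrite /e1 !mxE; ring.
have lin0 : scalar e0 by move=> x X Y; rewrite /e0 !mxE; ring.
have := has_det_comp (has_det_comp (has_det_set_entry i0 k lin0)
  (has_det_set_entry i1 k lin1)) (IHs us).
rewrite /e0 /e1 !mxE !eqxx (negPf i01) (negPf i10) /=.
have -> : (a - b * c / d) * 1 + b / d * 0 = (a - b * c / d) by ring.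
rewrite mulr0 add0r mulr1.
have -> : (a - b * c / d) * d = a * d - b * c by field.
rewrite -exprS; apply: eq_has_det => X; apply/matrixP=> i j.
rewrite !mxE !eqxx inE (negPf i01) (negPf ks) /=.
have [->|jk] := eqVneq j k; last by rewrite !andbF /=.
rewrite (negPf ks) !andbT /=.
by case: (i == i0) => //; field.
Qed.

(** The action of the Jordan multiplication by the companion block on the four
    entries indexed by i0 and i1. *)
Definition block_op p w X : V := \matrix_(i, j)
  if (i == i0) && (j == i0) then p * X i0 i0 + 2^-1 * (w * X i0 i1 + X i1 i0)
  else if (i == i0) && (j == i1) then 2^-1 * (p * X i0 i1 + X i0 i0 + X i1 i1)
  else if (i == i1) && (j == i0) then 2^-1 * (p * X i1 i0 + w * X i0 i0 + w * X i1 i1)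
  else if (i == i1) && (j == i1) then 2^-1 * (w * X i0 i1 + X i1 i0)
  else X i j.

Hypothesis two_neq0 : (2%:R : K) != 0.

Lemma has_det_block_op p w : p != 0 ->
  has_det (- (w * (p / 2) ^+ 2)) (block_op p w).
Proof.
move=> p0.
(* The entries (i0, i1) and (i1, i0) are assigned first; e11 and then e00 are
   expressed through the new values. *)
pose e01 X := 2^-1 * (p * X i0 i1 + X i0 i0 + X i1 i1).
pose e10 X := 2^-1 * (p * X i1 i0 + w * X i0 i0 + w * X i1 i1).
pose e11 X := (w * X i0 i1 + X i1 i0 - w * X i0 i0 - w * X i1 i1) / p.
pose e00 X := p * X i0 i0 + X i1 i1.
have l01 : scalar e01 by move=> x X Y; rewrite /e01 !mxE; ring.
have l10 : scalar e10 by move=> x X Y; rewrite /e10 !mxE; ring.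
have l11 : scalar e11 by move=> x X Y; rewrite /e11 !mxE; ring.
have l00 : scalar e00 by move=> x X Y; rewrite /e00 !mxE; ring.
have := has_det_comp (has_det_comp (has_det_set_entry i0 i0 l00) (has_det_set_entry i1 i1 l11))
   (has_det_comp (has_det_set_entry i1 i0 l10) (has_det_set_entry i0 i1 l01)).
rewrite /e00 /e11 /e10 /e01 !mxE !eqxx (negPf i01) (negPf i10) /=.
have -> : (p * 1 + 0) * ((w * 0 + 0 - w * 0 - w * 1) / p) *
   (2^-1 * (p * 1 + w * 0 + w * 0) * (2^-1 * (p * 1 + 0 + 0))) = - (w * (p / 2) ^+ 2).
  by field; rewrite ?p0 ?two_neq0.
apply: eq_has_det => X; apply/matrixP=> i j.
rewrite !mxE !eqE /=.
by case: (index_cases i) => [->|->|[ii0 ii1]]; case: (index_cases j) => [->|->|[jj0 jj1]];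
  rewrite ?eqE ?ii0 ?ii1 ?jj0 ?jj1 //=; field; rewrite ?p0 ?two_neq0.
Qed.

(** The block [[p, 1], [w, 0]] on i0 and i1, and the identity elsewhere. *)
Definition block_companion p w : V :=
  1%:M + (p - 1) *: delta_mx i0 i0 + delta_mx i0 i1 + w *: delta_mx i1 i0 - delta_mx i1 i1.

(** L_A acts separately on the central block, on the columns and on the rows
    that meet it, through (1 + A) / 2 in the last two cases, and trivially on
    the remaining entries.  The exponent m is n - 2. *)
Lemma has_det_jordan_block : exists m, forall p w, p != 0 ->
  has_det (- (w * (p / 2) ^+ 2) * ((p + 1 - w) / 4%:R) ^+ m ^+ 2)
    (jordan_mul (block_companion p w)).
Proof.
pose s := [seq j <- enum 'I_n | (j != i0) && (j != i1)].
have us : uniq s by rewrite filter_uniq ?enum_uniq.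
have sE j : (j \in s) = (j != i0) && (j != i1).
  by rewrite mem_filter mem_enum andbT.
have n4 : (4%:R : K) != 0 by rewrite (natrM _ 2 2) mulf_neq0.
have h0 : (2^-1 : K) != 0 by rewrite invr_eq0.
exists (size s) => p w p0.
have := has_det_comp (has_det_block_op w p0) (has_det_comp
   (has_det_col_op ((p + 1) / 2) 2^-1 (w / 2) h0 us)
   (has_det_tr (has_det_col_op ((p + 1) / 2) (w / 2) 2^-1 h0 us))).
have -> : (p + 1) / 2 / 2 - 2^-1 * (w / 2) = (p + 1 - w) / 4%:R.
  by field; rewrite ?n4 ?two_neq0.
have -> : (p + 1) / 2 / 2 - w / 2 / 2 = (p + 1 - w) / 4%:R.
  by field; rewrite ?n4 ?two_neq0.
rewrite -expr2; apply: eq_has_det => X.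
rewrite /jordan_mul /block_companion; apply/matrixP=> i j.
rewrite !(mulmxDl, mulmxDr, mulNmx, mulmxN, mul1mx, mulmx1) -!(scalemxAl, scalemxAr).
rewrite !mul_delta_mxE !mul_mx_deltaE !mxE !sE !eqE /=.
by case: (index_cases i) => [->|->|[ii0 ii1]]; case: (index_cases j) => [->|->|[jj0 jj1]];
  rewrite ?eqE ?ii0 ?ii1 ?jj0 ?jj1 /=; field; rewrite ?two_neq0.
Qed.

End Determinants.

(** * All dilations are realizable *)

Section AllDilations.
Variables (K : fieldType) (n : nat).
Hypothesis two_neq0 : (2%:R : K) != 0.
Local Notation V := 'M[K]_n.

Definition matrix_op (M : 'M[K]_(n * n)) (X : V) : V := vec_mx (mxvec X *m M).

Definition realizable_mx M := realizable (matrix_op M).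

Lemma realizable_mxM A B :
  realizable_mx A -> realizable_mx B -> realizable_mx (A *m B).
Proof.
move=> SA SB; apply: eq_realizable (realizable_comp SB SA) => X.
by rewrite /matrix_op /= vec_mxK mulmxA.
Qed.

Lemma realizable_mx_shear A : shear_prod A -> realizable_mx A.
Proof.
elim=> {A} [|p q c pq|A B _ SA _ SB]; last exact: realizable_mxM.
  apply: eq_realizable (realizable_id n two_neq0) => X.
  by rewrite /matrix_op mulmx1 mxvecK.
case/mxvec_indexP: p pq => i j; case/mxvec_indexP: q => k l pq.
have klij : (k, l) != (i, j) by apply: contraNneq pq => -[-> ->].
apply: eq_realizable ((transvecs_delta two_neq0 klij).2 c) => X.
rewrite /matrix_op /transvec tr_deltaE mulmxDr mulmx1 linearD /= mxvecK.
congr (_ + _); rewrite -scalemxAr -[X in _ *m X](mul_delta_mx (0 : 'I_1)) mulmxA.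
have -> : mxvec X *m delta_mx (mxvec_index i j) 0 = (X i j)%:M.
  by rewrite -colE; apply/matrixP=> a b; rewrite !ord1 [LHS]mxE [RHS]mxE eqxx mxvecE.
by rewrite mul_scalar_mx scalerA linearZ /= vec_mx_delta.
Qed.

Lemma realizable_mx_det c (f : V -> V) : has_det c f -> realizable f ->
  exists2 M, \det M = c & realizable_mx M.
Proof.
move=> [M dM Mf] Sf; exists M => //; apply: eq_realizable Sf => X.
by rewrite /matrix_op -Mf mxvecK.
Qed.

Variables i0 i1 : 'I_n.
Hypothesis i01 : i0 != i1.
Let p0 := mxvec_index i0 i0.

(** L_A for A = 1 - E_00 is diagonal: its eigenvalue at E_00 is 0, the others
    are 1/2 and 1. *)
Lemma realizable_dilation0 : realizable_mx (dilation p0 0).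
Proof.
pose W : V := \matrix_(i, j) ((2%:R - (i == i0)%:R - (j == i0)%:R) / 2%:R).
have SW : realizable_mx (diag_mx (mxvec W)).
  apply: eq_realizable (realizable_jordan_mul (1%:M - delta_mx i0 i0)) => X.
  apply: (can_inj mxvecK); rewrite /matrix_op vec_mxK; apply/rowP=> k.
  case/mxvec_indexP: k => i j; rewrite mul_mx_diag mxvecE [RHS]mxE !mxvecE.
  rewrite /jordan_mul mulmxBl mulmxBr mul1mx mulmx1.
  rewrite mul_delta_mxE mul_mx_deltaE !mxE.
  by have [->|_] := eqVneq i i0; have [->|_] := eqVneq j i0; rewrite /=; field;
    rewrite two_neq0.
have := dilation_of_diag realizable_mxM realizable_mx_shear (p := p0) SW.
suff -> : \prod_q mxvec W 0 q = 0.
  apply=> q; case/mxvec_indexP: q => i j ij; rewrite mxvecE mxE.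
  rewrite mulf_neq0 ?invr_eq0 //.
  have [ii0|ii0] := eqVneq i i0; have [jj0|jj0] := eqVneq j i0.
  - by rewrite ii0 jj0 eqxx in ij.
  - by rewrite /= subr0 (_ : _ - _ = 1) ?oner_neq0 //=; ring.
  - by rewrite /= subr0 (_ : _ - _ = 1) ?oner_neq0 //=; ring.
  - by rewrite !subr0.
rewrite (bigD1 p0) //= mxvecE mxE eqxx.
by rewrite /= (_ : 2%:R - _ - _ = 0) ?mul0r //=; ring.
Qed.

(** Two companion multiplications with p = -2 and p = -1 have determinants
    whose product is (w1 w2 / 4) (((1 + w1) w2 / 16)^m)^2.  The choice
    w1 w2 = 4 c and (1 + w1) w2 = 16 e with e = 1 or -1 makes it equal to c. *)
Lemma realizable_dilation (c : K) : c != 0 -> realizable_mx (dilation p0 c).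
Proof.
move=> c0; have n4 : 4%:R != 0 :> K by rewrite (natrM _ 2 2) mulf_neq0.
have n16 : 16%:R != 0 :> K by rewrite (natrM _ 4 4) mulf_neq0.
(* One of the two signs keeps w2 away from 0, since 32 is not 0. *)
have [e e2 w20] : exists2 e : K, e ^+ 2 = 1 & 16%:R * e - 4%:R * c != 0.
  have [w0|] := eqVneq (16%:R * 1 - 4%:R * c) 0; last by exists 1; rewrite ?expr1n.
  exists (- 1); first by rewrite sqrrN expr1n.
  have -> : 16%:R * -1 - 4%:R * c = 16%:R * 1 - 4%:R * c - 2%:R * 16%:R by ring.
  by rewrite w0 sub0r oppr_eq0 mulf_neq0.
pose w2 := 16%:R * e - 4%:R * c; pose w1 := 4%:R * c / w2.
have [m dJ] := has_det_jordan_block i01 two_neq0.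
have m2 : - 2%:R != 0 :> K by rewrite oppr_eq0.
have m1 : - 1 != 0 :> K by rewrite oppr_eq0 oner_neq0.
have [M dM SM] := realizable_mx_det (has_det_comp (dJ _ w1 m2) (dJ _ w2 m1))
  (realizable_comp (realizable_jordan_mul _) (realizable_jordan_mul _)).
suff detM : \det M = c.
  by rewrite -detM; apply: (dilation_of_det realizable_mxM realizable_mx_shear);
    rewrite ?detM.
rewrite dM.
pose u1 := (- 2%:R + 1 - w1) / 4%:R; pose u2 := (- 1 + 1 - w2) / 4%:R.
have u12 : u1 * u2 = e.
  have -> : u1 * u2 = (w2 + 4%:R * c) / 16%:R.
    by rewrite /u1 /u2 /w1; field; rewrite [w2 != 0]w20 n4 n16.
  by rewrite /w2 subrK mulrAC divff // mul1r.
rewrite -/u1 -/u2 mulrACA -exprMn -exprMn u12 exprAC e2 expr1n mulr1.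
by rewrite /w1; field; rewrite ?w20 ?two_neq0.
Qed.
End AllDilations.

Theorem theorem1p1 (K : fieldType) (n : nat)
    (charK : 2%N \notin [pchar K]) (n_ge1 : (1 <= n)%N)
    (f : 'End('M[K]_n)) :
  JMS f.
Proof.
have two_neq0 : (2%:R : K) != 0 by move: charK; rewrite inE.
suff [g Sg gf] : realizable f by rewrite -(_ : g = f) //; apply/lfunP.
case: n n_ge1 f => [//|[|m]] _ f.
  (* Over 1 x 1 matrices f is the multiplication by f 1. *)
  exists (jordan_L (f 1)) => [|X]; first exact: JMS_L.
  have [x ->] : exists x, X = x *: 1 by exists (X 0 0); rewrite scalemx1 -mx11_scalar.
  rewrite jordan_LE -scalemxAl -scalemxAr mulmx1 mul1mx [in RHS]linearZ /=.
  by apply/matrixP=> i j; rewrite !mxE; field.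
have i01 : ord0 != ord_max :> 'I_m.+2 by [].
have Sdil c : realizable_mx (dilation (mxvec_index ord0 ord0) c : 'M[K]_(m.+2 * m.+2)).
  have [->|c0] := eqVneq c 0; first exact: realizable_dilation0.
  exact: (realizable_dilation two_neq0 i01 c0).
have := shears_and_dilations_generate (@realizable_mxM K m.+2)
  (@realizable_mx_shear K m.+2 two_neq0) Sdil (lin_mx f).
by apply: eq_realizable => X; rewrite /matrix_op mul_vec_lin mxvecK.
Qed.
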